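(* Let $(Q_i(t),\dot Q_i(t))_{i=1}^N$ be a superhyperbolic solution of the $N$-body problem. Then $$\limsup_{t\to\infty}\max_{i,j}|Q_i(t)-Q_j(t)|=\infty,\qquad \liminf_{t\to\infty}\min_{i\neq j}|Q_i(t)-Q_j(t)|=0.$$
   Context: The $N$-body problem: point masses $m_1,\dots,m_N>0$ at positions $Q_i(t)$ in Euclidean space satisfying Newton's equations $m_i\ddot Q_i=\sum_{j\ne i}m_im_j\frac{Q_j-Q_i}{|Q_j-Q_i|^3}$. A solution is called superhyperbolic if it is defined for all large times and its size grows super-linearly in time: $\frac{\max_i|Q_i(t)|}{t}\to\infty$ as $t\to\infty$. *)

(* Defs.v *)
From HB Require Import structures.
From mathcomp Require Import all_boot all_order all_algebra.
From mathcomp Require Import all_classical all_reals all_analysis.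
Import Order.TTheory GRing.Theory Num.Theory.
Import numFieldNormedType.Exports.

Set Implicit Arguments.
Unset Strict Implicit.
Unset Printing Implicit Defensive.

Local Open Scope classical_set_scope.
Local Open Scope ring_scope.

(* The library norm on 'rV[R]_d is the sup norm, hence this definition; both
   norms induce the same topology, so the library derivative of a curve in
   'rV[R]_d is the usual one. *)
Definition enorm (R : realType) (d : nat) (v : 'rV[R]_d) : R :=
  Num.sqrt (\sum_(k < d) v 0 k ^+ 2).

Section NBody.
Variables (R : realType) (N d : nat).
Implicit Types (m : 'I_N -> R) (Q : 'I_N -> R -> 'rV[R]_d) (t T : R).

Definition collision_free Q t : Prop :=
  forall i j : 'I_N, i != j -> Q i t != Q j t.

Definition newton_at m Q t : Prop :=
  forall i : 'I_N,
    [/\ derivable (Q i) t 1,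
        derivable ((Q i)^`())%classic t 1 &
        m i *: ((Q i)^`(2))%classic t =
        \sum_(j < N | j != i)
          (m i * m j / enorm (Q j t - Q i t) ^+ 3) *: (Q j t - Q i t)].

Definition nbody_solution m Q T : Prop :=
  forall t, T < t -> collision_free Q t /\ newton_at m Q t.

(* The default value 0 only matters for an empty index set, as norms are
   nonnegative. *)
Definition max_norm Q t : R :=
  \big[Num.max/0]_(i < N) enorm (Q i t).

Definition max_dist Q t : R :=
  \big[Num.max/0]_(i < N) \big[Num.max/0]_(j < N) enorm (Q i t - Q j t).

(* Valued in the extended reals, so that the minimum over no pair is +oo. *)
Definition min_dist Q t : \bar R :=
  \big[mine/+oo%E]_(p : 'I_N * 'I_N | p.1 != p.2)
    (enorm (Q p.1 t - Q p.2 t))%:E.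

(* Only the values of Q at large times are relevant: a solution may be extended
   arbitrarily to times t <= T. *)
Definition superhyperbolic m Q : Prop :=
  (exists T, nbody_solution m Q T) /\
  max_norm Q t / t @[t --> +oo] --> +oo.

End NBody.

(* Main.v *)
Require Import Defs.
From HB Require Import structures.
From mathcomp Require Import all_boot all_order all_algebra.
From mathcomp Require Import all_classical all_reals all_analysis.
From mathcomp Require Import ring lra.
Import Order.TTheory GRing.Theory Num.Theory.
Import numFieldNormedType.Exports.

Local Open Scope classical_set_scope.
Local Open Scope ring_scope.

(** Along a superhyperbolic solution some coordinate of some body must outgrow
    every multiple of t ([superhyperbolic_not_at_most_linear]).  Each of the two
    conclusions is proved by showing that its failure makes all coordinates grow
    at most linearly.

    If the mutual distances stay bounded, every body stays at bounded distance
    from the barycenter.  The internal forces cancel, so the barycenter moves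
    with constant velocity and hence grows at most linearly
    ([barycenter_at_most_linear]); so does every body.

    If the mutual distances stay above some e > 0, the potential energy is
    bounded.  The total energy is conserved ([is_derive_energy]), so the
    kinetic energy is bounded as well, hence so are all the velocities, and
    positions grow at most linearly.

    Both conservation laws hold only for large times, so they are obtained from
    a mean value inequality on a half-line rather than on the whole line
    ([mean_value_bound]). *)

Set Implicit Arguments.
Unset Strict Implicit.
Unset Printing Implicit Defensive.

(** * Growth of functions on a half-line *)

Lemma mean_value_bound (R : realType) (f df : R -> R) (C T : R) :
    (forall t, T < t -> is_derive t 1 f (df t)) ->
    (forall t, T < t -> `|df t| <= C) ->
  forall s t, T < s -> s <= t -> `|f t - f s| <= C * (t - s).
Proof.
move=> fdf dfC s t Ts st.
have [||c] := @MVT_segment R f df s t st.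
- by move=> u; rewrite in_itv /= => /andP[su _]; apply: fdf; exact: lt_trans su.
- apply: derivable_within_continuous => u; rewrite in_itv /= => /andP[su _].
  by have [] := fdf u (lt_le_trans Ts su).
rewrite in_itv /= => /andP[sc _] ->.
rewrite normrM [`|t - s|]ger0_norm ?subr_ge0//.
by apply: ler_wpM2r; [rewrite subr_ge0|apply: dfC; exact: lt_le_trans sc].
Qed.

Lemma zero_derive_eventually_constant (R : realType) (f : R -> R) :
    (\forall t \near pinfty_nbhs R, is_derive (t : R) (1 : R) f 0) ->
  exists c, \forall t \near pinfty_nbhs R, f t = c.
Proof.
move=> [T [_ f'0]]; exists (f (T + 1)); near=> t.
(* A derivative bounded by C = 0 leaves no room between f t and f (T + 1). *)
have Tt : T + 1 <= t by near: t; exact/nbhs_pinfty_ge/num_real.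
apply/eqP; rewrite -subr_eq0 -normr_le0 -[leRHS](mul0r (t - (T + 1))).
apply: (@mean_value_bound R f (fun=> 0) 0 T) => //; last by rewrite ltrDl.
by move=> ? _; rewrite normr0.
Unshelve. all: by end_near. Qed.

Definition at_most_linear (R : realType) (f : R -> R) : Prop :=
  exists C, \forall t \near pinfty_nbhs R, `|f t| <= C * t.

Lemma bounded_derive_at_most_linear (R : realType) (f df : R -> R) (C : R) :
    (\forall t \near pinfty_nbhs R, is_derive (t : R) (1 : R) f (df t)) ->
    (\forall t \near pinfty_nbhs R, `|df t| <= C) ->
  at_most_linear f.
Proof.
move=> fdf dfC; have [T [_ H]] := filterI fdf dfC.
pose s := T + 1; have Ts : T < s by rewrite ltrDl.
have C0 : 0 <= C by apply: le_trans (H _ Ts).2.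
(* For t >= 1 and t >= s the bound |f s| + C (t - s) is at most
   (|f s| + C (1 + |s|)) t; the term |s| absorbs a negative s. *)
exists (`|f s| + C * (1 + `|s|)); near=> t.
have st : s <= t by near: t; exact/nbhs_pinfty_ge/num_real.
have t1 : 1 <= t by near: t; exact/nbhs_pinfty_ge/num_real.
have := mean_value_bound (fun t Tt => (H t Tt).1)
  (fun t Tt => (H t Tt).2) Ts st.
have := ler_normD (f t - f s) (f s); rewrite subrK => h1 h2.
have h3 : 0 <= C * (`|s| + s).
  by rewrite mulr_ge0 // -lerBlDr sub0r -normrN ler_norm.
have h4 : 0 <= C * `|s| * (t - 1) by rewrite !mulr_ge0 // subr_ge0.
have h5 : 0 <= `|f s| * (t - 1) by rewrite !mulr_ge0 // subr_ge0.
nra.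
Unshelve. all: by end_near. Qed.

Lemma is_derive_coord (R : realType) (d : nat) (u : R -> 'rV[R]_d)
    (t : R) k : derivable u t 1 ->
  is_derive t 1 (fun s => u s 0 k) (u^`()%classic t 0 k).
Proof.
move=> ud; apply: DeriveDef; first by have /derivable_mxP := ud; apply.
by rewrite derive1E derive_mx // mxE.
Qed.

(** * Double sums of antisymmetric terms *)

(** Newton's third law for a double sum: exchanging the two indices and
    averaging both forms turns v i into half of v i - v j.  A constant v gives
    the vanishing of the total force, and v the velocities give the power of
    the internal forces in terms of relative velocities. *)
Lemma sum_antisymmetric (R : realType) (N : nat) (v : 'I_N -> R)
    (w : 'I_N -> 'I_N -> R) : (forall i j, w j i = - w i j) ->
  \sum_i v i * \sum_j w i j = 2^-1 * \sum_i \sum_j (v i - v j) * w i j.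
Proof.
move=> wN; have -> : \sum_i \sum_j (v i - v j) * w i j =
    \sum_i v i * \sum_j w i j + \sum_i \sum_j v j * w j i.
  rewrite -big_split; apply: eq_bigr => i _; rewrite mulr_sumr -big_split.
  by apply: eq_bigr => j _ /=; rewrite (wN i j); ring.
rewrite [X in _ + X]exchange_big /=.
under [X in _ + X]eq_bigr do rewrite -mulr_sumr.
by field.
Qed.

(** * The Euclidean norm *)

Section Enorm.
Variables (R : realType) (d : nat).
Implicit Types v : 'rV[R]_d.

Lemma enorm_ge0 v : 0 <= enorm v. Proof. exact: sqrtr_ge0. Qed.

Lemma enorm0 : enorm (0 : 'rV[R]_d) = 0.
Proof. by rewrite /enorm big1 ?sqrtr0// => k _; rewrite mxE expr0n. Qed.

Lemma enormN v : enorm (- v) = enorm v.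
Proof. by congr Num.sqrt; apply: eq_bigr => k _; rewrite mxE sqrrN. Qed.

Lemma coord_le_enorm v k : `|v 0 k| <= enorm v.
Proof.
rewrite -sqrtr_sqr ler_wsqrtr// (bigD1 k)//= lerDl sumr_ge0// => l _.
exact: sqr_ge0.
Qed.

(** Squaring, this is the sum of squares against the square of the sum: each
    factor |v k| is at most the whole sum. *)
Lemma enorm_le_sum v : enorm v <= \sum_k `|v 0 k|.
Proof.
have s0 : 0 <= \sum_k `|v 0 k| by apply: sumr_ge0.
rewrite -[leRHS]ger0_norm// -sqrtr_sqr ler_wsqrtr// expr2 mulr_suml.
apply: ler_sum => k _; rewrite -[leLHS]ger0_norm ?sqr_ge0//.
rewrite normrX expr2 ler_wpM2l//.
by rewrite (bigD1 k)//= lerDl sumr_ge0.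
Qed.

Lemma sqr_sum_gt0 v : v != 0 -> 0 < \sum_k v 0 k ^+ 2.
Proof.
move=> v0; rewrite lt_def sumr_ge0 ?andbT => [|k _]; last exact: sqr_ge0.
apply: contra v0; rewrite psumr_eq0 => [/allP h|k _]; last exact: sqr_ge0.
apply/eqP/rowP => k; rewrite mxE; apply/eqP.
by rewrite -sqrf_eq0; apply: h; rewrite mem_index_enum.
Qed.

(** The chain rule applied to S^(-1/2) with S the sum of squares; the sum is
    written with the factor u / |u|^3 of the Newtonian force. *)
Lemma is_derive_inv_enorm (u : R -> 'rV[R]_d) (t : R) (du : 'I_d -> R) :
    (forall k, is_derive t 1 (fun s => u s 0 k) (du k)) -> u t != 0 ->
  is_derive t 1 (fun s => (enorm (u s))^-1)
    (- \sum_k du k * (u t 0 k / enorm (u t) ^+ 3)).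
Proof.
move=> udu ut0; have S0 := sqr_sum_gt0 ut0.
pose S s := \sum_k u s 0 k ^+ 2.
have dS : is_derive t 1 S (\sum_k (2 * u t 0 k * du k)).
  rewrite (_ : S = \sum_k ((fun s => u s 0 k) ^+ 2)).
    apply: is_derive_eq; apply: eq_bigr => k _.
    by rewrite /= expr1.
  by apply/funext => s; rewrite fct_sumE.
have dsq := is_derive1_sqrt S0.
have dr := @is_derive1_comp R Num.sqrt S t _ _ dsq dS.
have r0 : Num.sqrt (S t) != 0 by rewrite gt_eqF// sqrtr_gt0.
have := @is_deriveV R (Num.sqrt \o S) t _ _ r0 dr.
move=> /is_derive_eq; apply.
rewrite /GRing.scale /= !mulr_sumr -sumrN; apply: eq_bigr => k _.
rewrite -/(S t) /enorm -/(S t); field.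
by rewrite r0.
Qed.

End Enorm.

(** * Conservation laws *)

Section NBody.
Variables (R : realType) (N d : nat) (m : 'I_N -> R).
Variable Q : 'I_N -> R -> 'rV[R]_d.
Hypothesis m_gt0 : forall i, 0 < m i.

Definition vel (i : 'I_N) (k : 'I_d) (t : R) : R := ((Q i)^`())%classic t 0 k.

Definition force (i j : 'I_N) (k : 'I_d) (t : R) : R :=
  m i * m j / enorm (Q j t - Q i t) ^+ 3 * (Q j t - Q i t) 0 k.

(** The sums run over all ordered pairs, so each pair of bodies is counted twice
    and the common factor 1/2 gives the usual energy; the diagonal terms are
    zero because the inverse of 0 is 0. *)
Definition energy (t : R) : R :=
  2^-1 * (\sum_i \sum_k m i * vel i k t ^+ 2 -
          \sum_i \sum_j m i * m j / enorm (Q j t - Q i t)).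

Lemma force_antisymmetric i j k t : force j i k t = - force i j k t.
Proof.
by rewrite /force -[Q i t - Q j t]opprB enormN mxE (mulrC (m j)) mulrN.
Qed.

Lemma is_derive_vel t i k : newton_at m Q t ->
  is_derive t 1 (vel i k) ((m i)^-1 * \sum_j force i j k t).
Proof.
move=> /(_ i)[_ dv eqn]; apply: is_derive_eq; first exact: is_derive_coord.
move/rowP: eqn => /(_ k); rewrite mxE summxE derive1nS derive1n1 => eqn.
apply: (mulfI (lt0r_neq0 (m_gt0 i))); rewrite eqn mulVKf ?gt_eqF//.
rewrite [RHS](bigD1 i)//= {1}/force subrr mxE mulr0 add0r.
by apply: eq_bigr => j _; rewrite mxE.
Qed.

(** The diagonal case i = j is included on purpose: both sides vanish there,
    and sums over all pairs need no side condition. *)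
Lemma is_derive_potential t i j : collision_free Q t -> newton_at m Q t ->
  is_derive t 1 (fun s => m i * m j / enorm (Q j s - Q i s))
    (\sum_k (vel i k t - vel j k t) * force i j k t).
Proof.
move=> cf nw; have [<-|ij] := eqVneq i j.
  rewrite (_ : (fun _ => _) = cst 0); last first.
    by apply/funext => s; rewrite subrr enorm0 invr0 mulr0.
  by apply: is_derive_eq; rewrite big1// => k _; rewrite subrr mul0r.
have dq k : is_derive t 1 (fun s => (Q j s - Q i s) 0 k)
    (vel j k t - vel i k t).
  rewrite (_ : (fun _ => _) = (fun s => Q j s 0 k) - (fun s => Q i s 0 k)).
    apply: is_deriveB; apply: is_derive_coord; first by have [] := nw j.
    by have [] := nw i.
  by apply/funext => s; rewrite !mxE.
have r0 : Q j t - Q i t != 0 by rewrite subr_eq0 eq_sym cf.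
have := @is_deriveZ R R R _ (m i * m j) t 1 _ (is_derive_inv_enorm dq r0).
move=> /is_derive_eq; apply.
rewrite /GRing.scale /= mulrN mulr_sumr -sumrN; apply: eq_bigr => k _.
by rewrite /force; ring.
Qed.

(** Coordinate by coordinate, the power of the forces, rewritten with relative
    velocities by [sum_antisymmetric], is the derivative of the potential
    terms. *)
Lemma is_derive_energy t : collision_free Q t -> newton_at m Q t ->
  is_derive t 1 energy 0.
Proof.
move=> cf nw.
have dv i k := is_derive_vel i k nw.
have dp i j := is_derive_potential i j cf nw.
rewrite (_ : energy = 2^-1 *: (\sum_i \sum_k m i *: vel i k ^+ 2 -
    \sum_i \sum_j (fun s => m i * m j / enorm (Q j s - Q i s)))); last first.
  apply/funext => s; rewrite /energy /GRing.scale /=; congr (_ * (_ - _)).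
    rewrite fct_sumE; apply: eq_bigr => i _; rewrite fct_sumE.
    exact: eq_bigr.
  by rewrite fct_sumE; apply: eq_bigr => i _; rewrite fct_sumE.
apply: is_derive_eq; apply/eqP; rewrite scaler_eq0; apply/orP; right.
rewrite subr_eq0; apply/eqP.
rewrite exchange_big [RHS](eq_bigr _ (fun i _ => exchange_big _ _ _ _ _ _)) /=.
rewrite [RHS]exchange_big; apply: eq_bigr => k _ /=.
have := @sum_antisymmetric R N (vel^~ k ^~ t) (fun i j => force i j k t)
  (fun i j => force_antisymmetric i j k t).
move/(congr1 ( *%R 2)); rewrite mulVKf ?pnatr_eq0// => <-.
rewrite mulr_sumr; apply: eq_bigr => i _; rewrite /GRing.scale /= expr1.
by have := lt0r_neq0 (m_gt0 i); move=> ?; field.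
Qed.

(** Not divided by the total mass, so that its derivative is the total
    momentum. *)
Definition barycenter k (t : R) : R := \sum_i m i * Q i t 0 k.

(** The total force vanishes by [sum_antisymmetric] with unit weights, so the
    momentum, which is the derivative of the barycenter, is constant. *)
Lemma barycenter_at_most_linear k : (exists T, nbody_solution m Q T) ->
  at_most_linear (barycenter k).
Proof.
move=> [T sol].
have nw : \forall t \near pinfty_nbhs R, newton_at m Q t.
  by exists T; split; [exact: num_real|move=> t /sol[]].
have db : \forall t \near pinfty_nbhs R,
    is_derive (t : R) (1 : R) (barycenter k) (\sum_i m i * vel i k t).
  near=> t; have nwt : newton_at m Q t by near: t.
  rewrite (_ : barycenter k = \sum_i m i *: (fun s => Q i s 0 k)); last first.
    by apply/funext => s; rewrite fct_sumE.
  apply: is_derive_sum => i; apply: is_deriveZ; apply: is_derive_coord.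
  by have [] := nwt i.
have [c cE] : exists c,
    \forall t \near pinfty_nbhs R, \sum_i m i * vel i k t = c.
  apply: zero_derive_eventually_constant; near=> t.
  have nwt : newton_at m Q t by near: t.
  have dv i := is_derive_vel i k nwt.
  rewrite (_ : (fun _ => _) = \sum_i m i *: vel i k); last first.
    by apply/funext => s; rewrite fct_sumE.
  apply: is_derive_eq.
  under eq_bigr do rewrite /GRing.scale /= mulVKf ?lt0r_neq0//.
  have := @sum_antisymmetric R N (fun=> 1) (fun i j => force i j k t)
    (fun i j => force_antisymmetric i j k t).
  rewrite /=; under eq_bigr do rewrite mul1r.
  move=> ->; rewrite big1 ?mulr0// => i _; rewrite big1// => j _.
  by rewrite subrr mul0r.
apply: bounded_derive_at_most_linear db _.
by apply: filterS cE => t ->; exact: lexx.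
Unshelve. all: by end_near. Qed.

End NBody.

(** * Superhyperbolic solutions *)

(** The finitely many linear bounds hold simultaneously for large t, and the
    sum of their slopes bounds max_norm Q t / t. *)
Lemma superhyperbolic_not_at_most_linear (R : realType) (N d : nat)
    (m : 'I_N -> R) (Q : 'I_N -> R -> 'rV[R]_d) : superhyperbolic m Q ->
  ~ (forall i k, at_most_linear (fun t => Q i t 0 k)).
Proof.
move=> [_ /cvgryPgt super] lin.
have /choice[C CP] : forall p : 'I_N * 'I_d, exists C,
    \forall t \near pinfty_nbhs R, `|Q p.1 t 0 p.2| <= C * t.
  by case=> i k; exact: lin.
have all_le : \forall t \near pinfty_nbhs R,
    forall p, `|Q p.1 t 0 p.2| <= C p * t.
  exact: filter_forall.
pose B := \sum_p `|C p|.
suff : \forall t \near pinfty_nbhs R, False by case/filter_ex.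
near=> t.
have t0 : 0 < t by near: t; exact/nbhs_pinfty_gt/num_real.
have CQ : forall p, `|Q p.1 t 0 p.2| <= C p * t by near: t.
have : B < max_norm Q t / t by near: t; exact: super.
rewrite ltr_pdivlMr// ltNge => /negP; apply.
have Bt0 : 0 <= B * t by rewrite mulr_ge0 ?sumr_ge0// ltW.
apply: bigmax_le => // i _; apply: le_trans (enorm_le_sum _) _.
apply: (@le_trans _ _ (\sum_k `|C (i, k)| * t)).
  apply: ler_sum => k _; apply: le_trans (CQ (i, k)) _.
  by rewrite ler_wpM2r ?ler_norm// ltW.
rewrite -mulr_suml; apply: ler_wpM2r; first exact: ltW.
rewrite /B.
have -> : \sum_p `|C p| = \sum_j \sum_k `|C (j, k)|.
  by rewrite pair_bigA; apply: eq_bigr => -[].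
rewrite (bigD1 i)//= lerDl.
by rewrite !sumr_ge0// => j _; rewrite sumr_ge0.
Unshelve. all: by end_near. Qed.

Section Superhyperbolic.
Variables (R : realType) (N d : nat) (m : 'I_N -> R).
Variable Q : 'I_N -> R -> 'rV[R]_d.
Hypothesis m_gt0 : forall i, 0 < m i.
Hypothesis Qsuper : superhyperbolic m Q.

(** With M the total mass, M Q_i is the barycenter plus the m_j (Q_i - Q_j),
    which bounded distances keep bounded. *)
Lemma superhyperbolic_max_dist_unbounded D :
  ~ \forall t \near pinfty_nbhs R, max_dist Q t <= D.
Proof.
move=> QD; apply: superhyperbolic_not_at_most_linear Qsuper _ => i k.
have [C cC] := barycenter_at_most_linear m_gt0 k Qsuper.1.
pose M := \sum_j m j.
have M0 : 0 < M.
  by rewrite /M (bigD1 i)//= ltr_wpDr// sumr_ge0// => j _; exact: ltW.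
exists (D + C / M); near=> t.
have t1 : 1 <= t by near: t; exact/nbhs_pinfty_ge/num_real.
have ct : `|barycenter m Q k t| <= C * t by near: t.
have Dt : max_dist Q t <= D by near: t.
have dist_le j : `|Q i t 0 k - Q j t 0 k| <= D.
  apply: le_trans Dt.
  apply: le_trans (le_bigmax _ _ i); apply: le_trans (le_bigmax _ _ j).
  by have := coord_le_enorm (Q i t - Q j t) k; rewrite !mxE.
have D0 : 0 <= D by apply: le_trans (dist_le i).
have MQ : M * Q i t 0 k =
    barycenter m Q k t + \sum_j m j * (Q i t 0 k - Q j t 0 k).
  rewrite /barycenter -big_split /= /M mulr_suml.
  by apply: eq_bigr => j _; ring.
have : M * `|Q i t 0 k| <= C * t + M * D.
  rewrite -[M in leLHS]gtr0_norm// -normrM MQ.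
  apply: le_trans (ler_normD _ _) (lerD ct _).
  apply: le_trans (ler_norm_sum _ _ _) _; rewrite mulr_suml.
  by apply: ler_sum => j _; rewrite normrM gtr0_norm// ler_wpM2l// ltW.
rewrite mulrC -ler_pdivlMr// => /le_trans; apply.
rewrite mulrDl [M * D]mulrC mulfK ?gt_eqF// mulrDl addrC mulrAC lerD2r.
by rewrite ler_peMr.
Unshelve. all: by end_near. Qed.

(** Separation bounds the potential terms by U, and energy conservation then
    bounds m_i v^2 by 2 E + U for every velocity coordinate v. *)
Lemma superhyperbolic_not_separated e : 0 < e ->
  ~ \forall t \near pinfty_nbhs R,
      forall i j, i != j -> e <= enorm (Q i t - Q j t).
Proof.
move=> e0 sep; apply: superhyperbolic_not_at_most_linear Qsuper _ => i k.
have [T sol] := Qsuper.1.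
have nw : \forall t \near pinfty_nbhs R, collision_free Q t /\ newton_at m Q t.
  by exists T; split; [exact: num_real|move=> t /sol].
have [E EE] : exists E, \forall t \near pinfty_nbhs R, energy m Q t = E.
  apply: zero_derive_eventually_constant; near=> t.
  have [cf nwt] : collision_free Q t /\ newton_at m Q t by near: t.
  exact: is_derive_energy.
pose U := \sum_i \sum_j m i * m j / e.
(* The bound on the velocities uses |v| <= 1 + v^2. *)
apply: (@bounded_derive_at_most_linear R _ (vel Q i k)
  (1 + (2 * E + U) / m i)); near=> t.
  apply: is_derive_coord.
  by have [_ /(_ i)[]] : collision_free Q t /\ newton_at m Q t by near: t.
have /(congr1 ( *%R 2)) : energy m Q t = E by near: t.
rewrite mulVKf ?pnatr_eq0// => /eqP; rewrite subr_eq => /eqP kinE.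
have : \sum_i \sum_j m i * m j / enorm (Q j t - Q i t) <= U.
  apply: ler_sum => a _; apply: ler_sum => b _.
  have mm : 0 <= m a * m b by rewrite mulr_ge0// ltW.
  rewrite ler_wpM2l//; have [->|ab] := eqVneq a b.
    by rewrite subrr enorm0 invr0 invr_ge0 ltW.
  have : e <= enorm (Q b t - Q a t).
    suff: forall i j, i != j -> e <= enorm (Q i t - Q j t).
      by apply; rewrite eq_sym.
    by near: t.
  by move=> er; rewrite lef_pV2// posrE// (lt_le_trans e0).
have : m i * vel Q i k t ^+ 2 <=
    \sum_i \sum_k m i * vel Q i k t ^+ 2.
  have kin0 a b : 0 <= m a * vel Q a b t ^+ 2.
    by rewrite mulr_ge0 ?sqr_ge0// ltW.
  rewrite [leRHS](bigD1 i)//= [X in _ <= X + _](bigD1 k)//= -addrA lerDl.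
  by rewrite addr_ge0 ?sumr_ge0// => a _; rewrite sumr_ge0.
rewrite kinE => h1 h2.
have : vel Q i k t ^+ 2 <= (2 * E + U) / m i.
  by rewrite ler_pdivlMr// mulrC (le_trans h1)// lerD2l.
rewrite -real_normK ?num_real//; set v := `|vel _ _ _ _| => v2.
have v0 : 0 <= v := normr_ge0 _.
have := sqr_ge0 (v - 1); nra.
Unshelve. all: by end_near. Qed.

End Superhyperbolic.

(** * Limits superior and inferior *)

Lemma limf_esup_eq_pinfty (R : realType) (f : R -> R) (F : set_system R)
    (FF : Filter F) : (forall D, ~ \forall t \near F, f t <= D) ->
  limf_esup (fun t => (f t)%:E) F = +oo%E.
Proof.
move=> unb; apply/eqP; apply: contrapT => /negP.
rewrite -ltey limf_esupE => /ereal_inf_lt[_ [V FV <-]] supV.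
have [D supD] : exists D : R, (ereal_sup [set (f t)%:E | t in V] <= D%:E)%E.
  by case: (ereal_sup _) supV => [D _|//|_]; [exists D|exists 0; exact: leNye].
apply: (unb D); apply: filterS FV => t Vt; rewrite -lee_fin.
by apply: le_trans supD; apply: ereal_sup_ubound; exists t.
Qed.

Lemma limf_einf_eq0 (R : realType) (f : R -> \bar R) (F : set_system R)
    (FF : Filter F) : (forall t, (0 <= f t)%E) ->
    (forall e, 0 < e -> ~ \forall t \near F, (e%:E <= f t)%E) ->
  limf_einf f F = 0%E.
Proof.
move=> f0 inf; apply/eqP; rewrite eq_le limf_einfE.
apply/andP; split; last first.
  apply: (@le_trans _ _ (ereal_inf (range f))).
    by apply: le_ereal_inf_tmp => _ [t _ <-].
  by apply: ereal_sup_ubound; exists setT => //; exact: (@filterT _ F).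
rewrite leNgt; apply/negP => /ereal_sup_gt[_ [V FV <-]] infV.
have [e e0 eV] : exists2 e, 0 < e & (e%:E <= ereal_inf (f @` V))%E.
  case: (ereal_inf _) infV => [e|_|//]; first by rewrite lte_fin; exists e.
  by exists 1 => //; exact: leey.
apply: (inf e e0); apply: filterS FV => t Vt; apply: le_trans eV _.
by apply: ereal_inf_lbound; exists t.
Qed.

Theorem theorem1p2 (R : realType) (N d : nat) (m : 'I_N -> R)
    (Q : 'I_N -> R -> 'rV[R]_d)
    (m_gt0 : forall i, 0 < m i)
    (Qsuper : superhyperbolic m Q) :
  limf_esup (fun t => (max_dist Q t)%:E) (pinfty_nbhs R) = +oo%E /\
  limf_einf (min_dist Q) (pinfty_nbhs R) = 0%E.
Proof.
split.
  apply: limf_esup_eq_pinfty => D.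
  by move/(superhyperbolic_max_dist_unbounded m_gt0 Qsuper).
apply: limf_einf_eq0 => [t|e e0 near_e].
  apply: le_bigmin => [|p _]; first exact: leey.
  by rewrite lee_fin enorm_ge0.
apply: (superhyperbolic_not_separated m_gt0 Qsuper e0).
apply: filterS near_e => t et i j ij; rewrite -lee_fin; apply: le_trans et _.
exact: (bigmin_le_cond _ (j := (i, j))).
Qed.
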